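(* The posterior probability $\gamma^\delta$ (the conditional distribution of $u$ given $\delta$) is absolutely continuous with respect to the prior probability $\gamma$, and its Radon-Nikodym derivative satisfies $$\frac{d\gamma^\delta}{d\gamma}(u)\propto\exp(-\Phi(u,\delta)),$$ that is, $\frac{d\gamma^\delta}{d\gamma}(u)=Z(\delta)^{-1}\exp(-\Phi(u,\delta))$ with normalizing constant $Z(\delta)=\int_U\exp(-\Phi(u,\delta))\,d\gamma(u)$.
   Context: Let $\Omega\subset\mathbb{R}^d$ be a bounded Lipschitz domain and $x_0\in\Omega$. Let $s_*,\overline{s},\psi_i\in L^\infty(\Omega)$ ($i\in\mathbb{N}$) with $s_*\ge 0$, and put $b_i=\|\psi_i\|_{L^\infty(\Omega)}$. Assume there are constants $c>0$ and $p>1$ with $b_i<c\,i^{-p}$ for all $i$. Let $U=\{u=(u_1,u_2,\dots)\in\mathbb{R}^{\mathbb{N}}:\sum_{i=1}^\infty|u_i|b_i<\infty\}$, let $\Theta$ be the restriction to $U$ of the product $\sigma$-algebra $\bigotimes_{i=1}^\infty\mathcal{B}(\mathbb{R})$, and let the prior $\gamma$ be the restriction to $U$ of the product Gaussian measure $\bigotimes_{i=1}^\infty\mathcal{N}(0,1)$; $\gamma(U)=1$. The slowness function is $$s(x,u)=s_*(x)+\exp\Big(\overline{s}(x)+\sum_{i=1}^\infty u_i\psi_i(x)\Big),\qquad u\in U,$$ and $s(\cdot,u)$ is assumed continuous and positive on $\overline\Omega$ for each $u\in U$. For $u\in U$, $T(\cdot,u)$ is the solution of the eikonal equation $|\nabla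 T(x,u)|=s(x,u)$, $T(x_0,u)=0$, with Soner boundary condition $\nabla T(x,u)\cdot n(x)\ge 0$ on $\partial\Omega$ ($n$ the outward unit normal); it is represented by $$T(x,u)=\inf_{\xi\in\Xi_{x_0}(x)}\int_0^1 s(\xi(r),u)|\xi'(r)|\,dr,\quad \Xi_{x_0}(x)=\{\xi\in W^{1,\infty}([0,1],\overline\Omega):\xi(0)=x_0,\ \xi(1)=x\}.$$ Fix points $x^1,\dots,x^N\in\overline\Omega$ and define $G:U\to\mathbb{R}^N$, $G(u)=(T(x^1,u),\dots,T(x^N,u))$. Let $\Sigma$ be a known positive definite $N\times N$ matrix, $|\cdot|$ the Euclidean norm, $|\cdot|_\Sigma=|\Sigma^{-1/2}\cdot|$, and $\Phi(u,\delta)=\frac12|\delta-G(u)|_\Sigma^2$. The observation is $\delta=G(u)+\vartheta$, where $u\sim\gamma$ and the noise $\vartheta\sim\mathcal{N}(0,\Sigma)$ is independent of $u$. The posterior $\gamma^\delta=P(u\mid\delta)$ is the regular conditional distribution of $u$ given $\delta$ on $(U,\Theta)$. As usual, a conditional distribution is determined only up to a null set of data $\delta$, and the statement is understood in that sense. *)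

(* Defs.v *)
From HB Require Import structures.
From mathcomp Require Import all_boot all_order all_algebra.
From mathcomp Require Import all_classical all_reals all_analysis.
From mathcomp Require Import measurable_realfun.

Set Implicit Arguments.
Unset Strict Implicit.
Unset Printing Implicit Defensive.

Import Order.TTheory GRing.Theory Num.Theory.
Import numFieldNormedType.Exports.

Local Open Scope classical_set_scope.
Local Open Scope ring_scope.

(* The norm [`|v|] of the library on ['cV[R]_n] is the sup-norm; it induces the
   same topology but is not the norm of the eikonal equation. *)
Definition dotv (R : realType) n (v w : 'cV[R]_n) : R :=
  \sum_i v i ord0 * w i ord0.

Definition enorm (R : realType) n (v : 'cV[R]_n) : R := Num.sqrt (dotv v v).

(* Sigma-algebra generated by the entries; on ['cV[R]_n] it is the Borel one. *)
Definition mx_measurable (R : realType) m n : set (set 'M[R]_(m, n)) :=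
  <<s \bigcup_(ij : 'I_m * 'I_n) preimage_set_system setT
        (fun A : 'M[R]_(m, n) => (A ij.1 ij.2 : measurableTypeR R))
        measurable >>.

Fact mx_display : measure_display. Proof. by []. Qed.

HB.instance Definition _ (R : realType) m n :=
  @isMeasurable.Build mx_display 'M[R]_(m, n) (@mx_measurable R m n)
    (@sigma_algebra0 _ _ _) (@sigma_algebraC _ _) (@sigma_algebra_bigcup _ _ _).

Lemma measurable_mx_entry (R : realType) m n (i : 'I_m) (j : 'I_n) :
  measurable_fun setT (fun A : 'M[R]_(m, n) => (A i j : measurableTypeR R)).
Proof.
move=> _ B mB; apply: sub_sigma_algebra.
by exists (i, j) => //; exists B.
Qed.

Lemma measurable_fun_mxP (R : realType) d (T : measurableType d) m n
    (f : T -> 'M[R]_(m, n)) :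
  (forall i j, measurable_fun setT (fun x => (f x i j : measurableTypeR R))) ->
  measurable_fun setT f.
Proof.
move=> mf; apply: (@measurability _ _ _ _ setT f
  (\bigcup_(ij : 'I_m * 'I_n) preimage_set_system setT
     (fun A : 'M[R]_(m, n) => (A ij.1 ij.2 : measurableTypeR R)) measurable))
  => //.
move=> _ [_ [[i j] _ [B mB <-]] <-]; rewrite !setTI.
by have := mf i j measurableT B mB; rewrite setTI.
Qed.

Section lebesgue_measure_vector.
Context {R : realType}.

Definition vcons n (p : measurableTypeR R * 'cV[R]_n) : 'cV[R]_n.+1 :=
  \col_i (if unlift ord0 i is Some j then p.2 j ord0 else p.1).

Definition vuncons n (v : 'cV[R]_n.+1) : measurableTypeR R * 'cV[R]_n :=
  (v ord0 ord0, \col_j v (lift ord0 j) ord0).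

Lemma vconsK n : cancel (@vcons n) (@vuncons n).
Proof.
move=> [x v]; rewrite /vuncons/= !mxE unlift_none; congr pair.
by apply/matrixP => i j; rewrite !mxE liftK (ord1 j).
Qed.

Lemma measurable_vcons n : measurable_fun setT (@vcons n).
Proof.
apply: measurable_fun_mxP => i j; rewrite /vcons.
under eq_fun do rewrite mxE.
case: unliftP => [k _|_]; last exact: measurable_fst.
apply: (@measurableT_comp _ _ _ _ _ _
  (fun A : 'cV[R]_n => (A k ord0 : measurableTypeR R)) _ snd).
  exact: measurable_mx_entry.
exact: measurable_snd.
Qed.

Lemma measurable_vuncons n : measurable_fun setT (@vuncons n).
Proof.
apply: measurable_fun_pair; first exact: measurable_mx_entry.
apply: measurable_fun_mxP => i j.
rewrite /=; under eq_fun do rewrite mxE.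
exact: measurable_mx_entry.
Qed.

Section step.
Variables (n : nat) (mu : {sigma_finite_measure set 'cV[R]_n -> \bar R}).

Definition lebesgue_vcons : set 'cV[R]_n.+1 -> \bar R :=
  pushforward (lebesgue_measure \x mu)%E (@vcons n).

Let lebesgue_vcons0 : lebesgue_vcons set0 = 0%E.
Proof. by rewrite /lebesgue_vcons /pushforward preimage_set0 measure0. Qed.

Let lebesgue_vcons_ge0 A : (0 <= lebesgue_vcons A)%E.
Proof. by rewrite /lebesgue_vcons /pushforward measure_ge0. Qed.

Let lebesgue_vcons_sigma_additive : semi_sigma_additive lebesgue_vcons.
Proof.
have mpre A : measurable A -> measurable (@vcons n @^-1` A).
  by move=> mA; rewrite -[X in measurable X]setTI; exact: measurable_vcons.
move=> F mF tF mUF; rewrite /lebesgue_vcons /pushforward preimage_bigcup.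
apply: measure_semi_sigma_additive => [k||]; first exact: mpre.
  apply/trivIsetP => /= i j _ _ ij; rewrite -preimage_setI.
  by move/trivIsetP : tF => /(_ _ _ _ _ ij) ->//; rewrite preimage_set0.
by rewrite -preimage_bigcup; exact: mpre.
Qed.

HB.instance Definition _ := isMeasure.Build _ _ _ lebesgue_vcons
  lebesgue_vcons0 lebesgue_vcons_ge0 lebesgue_vcons_sigma_additive.

Let lebesgue_vcons_sigma_finite : sigma_finite setT lebesgue_vcons.
Proof.
have /sigma_finiteP[F [TF ndF Foo]] := sigma_finiteT (@lebesgue_measure R).
have /sigma_finiteP[G [TG ndG Goo]] := sigma_finiteT mu.
exists (fun k => @vuncons n @^-1` (F k `*` G k)).
  rewrite -preimage_bigcup -[LHS](preimage_setT (@vuncons n)); congr preimage.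
  apply/esym; rewrite -subTset => -[x y] _.
  have [k _ Fkx] : (\bigcup_i F i) x by rewrite -TF.
  have [l _ Gly] : (\bigcup_i G i) y by rewrite -TG.
  exists (maxn k l) => //; split => /=.
    by move: x Fkx; exact/subsetPset/ndF/leq_maxl.
  by move: y Gly; exact/subsetPset/ndG/leq_maxr.
move=> k; have [mF Fk] := Foo k; have [mG Gk] := Goo k; split.
  rewrite -[X in measurable X]setTI.
  by apply: measurable_vuncons => //; exact: measurableX.
rewrite /lebesgue_vcons /pushforward -comp_preimage.
rewrite (_ : _ \o _ = id); last by apply/funext => p /=; rewrite vconsK.
by rewrite preimage_id product_measure1E// lte_mul_pinfty// ge0_fin_numE.
Qed.

HB.instance Definition _ := Measure_isSigmaFinite.Build _ _ _ lebesgue_vcons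
  lebesgue_vcons_sigma_finite.

End step.

Fixpoint lebesgue_vec (n : nat) : {sigma_finite_measure set 'cV[R]_n -> \bar R} :=
  match n with
  | 0 => \d_(0 : 'cV[R]_0)
  | m.+1 => lebesgue_vcons (lebesgue_vec m)
  end.

End lebesgue_measure_vector.

(* A member of L^oo(D) is given by a Borel representative; values outside D are
   irrelevant, since [f \_ D] is [f] extended by 0 outside D. *)
Definition in_Linfty (R : realType) d (D : set 'cV[R]_d) (f : 'cV[R]_d -> R) :=
  (f \_ D) \in Lfun (lebesgue_vec d) +oo%E.

Definition Linfty_norm (R : realType) d (D : set 'cV[R]_d) (f : 'cV[R]_d -> R)
    : R :=
  fine ('N[lebesgue_vec d]_+oo [EFin \o (f \_ D)])%E.

(* A domain is a connected open set. Near each boundary point it is required to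
   be, for some unit vector e, the strict epigraph in direction e of a Lipschitz
   function of the projection on the hyperplane orthogonal to e. Lipschitz
   continuity does not depend on the norm chosen on R^d. *)
Definition lipschitz_domain (R : realType) d (D : set 'cV[R]_d) :=
  [/\ open D, connected D &
      forall z, closure D z -> ~ D z ->
        exists (e : 'cV[R]_d) (g : 'cV[R]_d -> R),
          [/\ enorm e = 1,
              exists L : R, forall x y, `|g x - g y| <= L * enorm (x - y) &
              \forall y \near z, D y <-> g (y - dotv y e *: e) < dotv y e]].

(* C_c^oo functions on the open interval ]0, 1[. *)
Definition test_function01 (R : realType) (phi : R -> R) :=
  (forall n x, derivable (derive1n n phi) x 1) /\
  exists a b : R, [/\ 0 < a, b < 1 & forall x, ~~ (a <= x <= b) -> phi x = 0].

Definition weak_derivative01 (R : realType) (f g : R -> R) :=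
  forall phi : R -> R, test_function01 phi ->
    \int[lebesgue_measure]_(r in `[0, 1]) (f r * derive1 phi r) =
    - \int[lebesgue_measure]_(r in `[0, 1]) (g r * phi r).

(* f belongs to W^{1,oo}([0, 1]), with weak derivative g. *)
Definition W1infty01 (R : realType) (f g : R -> R) :=
  [/\ (f \_ `[0, 1]) \in Lfun (@lebesgue_measure R) +oo%E,
      (g \_ `[0, 1]) \in Lfun (@lebesgue_measure R) +oo%E &
      weak_derivative01 f g].

(* xi is an element of the set of admissible curves from x0 to x (taken to be
   its continuous representative, so that its values at points make sense) and
   dxi represents its weak derivative. *)
Definition admissible_curve (R : realType) d (D : set 'cV[R]_d)
    (x0 x : 'cV[R]_d) (xi dxi : R -> 'cV[R]_d) :=
  [/\ {within `[0, 1], continuous xi},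
      forall i, W1infty01 (fun r => xi r i ord0) (fun r => dxi r i ord0),
      forall r, 0 <= r <= 1 -> closure D (xi r),
      xi 0 = x0 & xi 1 = x].

Definition travel_time (R : realType) d (D : set 'cV[R]_d) (x0 : 'cV[R]_d)
    (s : 'cV[R]_d -> R) (x : 'cV[R]_d) : R :=
  inf [set t | exists xi dxi, admissible_curve D x0 x xi dxi /\
    t = \int[lebesgue_measure]_(r in `[0, 1]) (s (xi r) * enorm (dxi r))].

Definition gradient (R : realType) d (phi : 'cV[R]_d -> R) (x : 'cV[R]_d)
    : 'cV[R]_d :=
  \col_i 'D_(delta_mx i ord0) phi x.

Definition C1_function (R : realType) d (phi : 'cV[R]_d -> R) :=
  (forall x, differentiable phi x) /\ continuous (gradient phi).

(* T is the viscosity solution of |grad T| = s, T(x0) = 0 with the Soner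
   boundary condition grad T . n >= 0. As T need not be differentiable and n
   need not exist at every boundary point, the latter has the usual meaning that
   the supersolution inequality holds up to the boundary: test functions touch T
   from below relative to the closure of D. (For T and the boundary of class
   C^1, the gradients of such test functions at a boundary point are the vectors
   grad T + l n with l >= 0, and |grad T + l n| >= s = |grad T| for all of them
   means grad T . n >= 0.) The equation is imposed away from the source x0. *)
Definition eikonal_soner_solution (R : realType) d (D : set 'cV[R]_d)
    (x0 : 'cV[R]_d) (s T : 'cV[R]_d -> R) :=
  [/\ {within closure D, continuous T}, T x0 = 0,
      forall phi x, C1_function phi -> D x -> x != x0 ->
        (\forall y \near x, D y -> T y - phi y <= T x - phi x) ->
        enorm (gradient phi x) <= s x &
      forall phi x, C1_function phi -> closure D x -> x != x0 ->
        (\forall y \near x, closure D y -> T x - phi x <= T y - phi y) ->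
        s x <= enorm (gradient phi x)].

(* R^N with the product of the Borel sigma-algebras. *)
Definition Rinf (R : realType) :=
  g_sigma_algebraType (\bigcup_(i : nat) preimage_set_system setT
    (fun u : nat -> R => (u i : measurableTypeR R)) measurable).

(* The set of sequences u with sum_i |u_i| b_i < oo. Sequences indexed by
   i = 1, 2, ... in the mathematics are indexed here by i = 0, 1, ... *)
Definition Uset (R : realType) (b : nat -> R) : set (nat -> R) :=
  [set u | cvgn (series (fun i => `|u i| * b i))].

Definition Useq (R : realType) (b : nat -> R) : Type :=
  {u : nat -> R | Uset b u}.

Lemma Uset0 (R : realType) (b : nat -> R) : Uset b (fun=> 0).
Proof.
rewrite /Uset/= (_ : series _ = cst 0); first exact: is_cvg_cst.
apply/funext => n; rewrite /series/= big1// => i _.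
by rewrite normr0 mul0r.
Qed.

HB.instance Definition _ (R : realType) (b : nat -> R) := gen_eqMixin (Useq b).
HB.instance Definition _ (R : realType) (b : nat -> R) :=
  gen_choiceMixin (Useq b).
HB.instance Definition _ (R : realType) (b : nat -> R) :=
  isPointed.Build (Useq b) (exist _ (fun=> 0) (@Uset0 R b)).

Definition useq (R : realType) (b : nat -> R) (u : Useq b) : Rinf R := sval u.

(* U with the restriction (trace) of the product sigma-algebra. *)
Definition Uspace (R : realType) (b : nat -> R) :=
  g_sigma_algebra_preimageType (@useq R b).

Definition Ucoord (R : realType) (b : nat -> R) (u : Uspace b) (i : nat) : R :=
  useq u i.

(* mu is the product measure of countably many copies of N(0,1). *)
Definition product_gaussian (R : realType) (mu : set (Rinf R) -> \bar R) :=
  forall (n : nat) (A : nat -> set (measurableTypeR R)),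
    (forall i, measurable (A i)) ->
    mu [set u | forall i, (i < n)%N -> A i (u i)] =
    (\prod_(i < n) normal_prob (0 : R) 1 (A i))%E.

Definition is_prior (R : realType) (b : nat -> R)
    (mu : set (Rinf R) -> \bar R) (gamma : set (Uspace b) -> \bar R) :=
  forall B : set (Rinf R), measurable B ->
    gamma (@useq R b @^-1` B) = mu (B `&` Uset b).

Definition posdefmx (R : realType) n (A : 'M[R]_n) :=
  A^T = A /\ forall v : 'cV[R]_n, v != 0 -> 0 < dotv v (A *m v).

(* S is the power -1/2 of A: the positive definite square root of the inverse. *)
Definition is_inv_sqrtmx (R : realType) n (A S : 'M[R]_n) :=
  posdefmx S /\ S *m S = invmx A.

(* Lebesgue density of N(0, A). *)
Definition gaussian_pdf (R : realType) n (A : 'M[R]_n) (v : 'cV[R]_n) : R :=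
  (Num.sqrt ((2 * pi) ^+ n * \det A))^-1 * expR (- dotv v (invmx A *m v) / 2).

Definition has_gaussian_law (R : realType) d (T : measurableType d)
    (P : probability T R) n (A : 'M[R]_n) (X : {RV P >-> 'cV[R]_n}) :=
  forall B : set 'cV[R]_n, measurable B ->
    distribution P X B =
    (\int[lebesgue_vec n]_(v in B) (gaussian_pdf A v)%:E)%E.

Definition independent_rv (R : realType) d d1 d2 (T : measurableType d)
    (T1 : measurableType d1) (T2 : measurableType d2) (P : probability T R)
    (X : {RV P >-> T1}) (Y : {RV P >-> T2}) :=
  forall A B, measurable A -> measurable B ->
    P (X @^-1` A `&` Y @^-1` B) = (P (X @^-1` A) * P (Y @^-1` B))%E.

(* kappa is a probability kernel such that, for each A, kappa (Y) (A) is a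
   version of the conditional probability of the event X in A given Y. *)
Definition regular_conditional_distribution (R : realType) d d1 d2
    (T : measurableType d) (T1 : measurableType d1) (T2 : measurableType d2)
    (P : probability T R) (X : {RV P >-> T1}) (Y : T -> T2)
    (kappa : T2 -> probability T1 R) :=
  (forall A, measurable A -> measurable_fun setT (kappa ^~ A)) /\
  forall A B, measurable A -> measurable B ->
    P (X @^-1` A `&` Y @^-1` B) = (\int[P]_(w in Y @^-1` B) kappa (Y w) A)%E.

(* S stands for the matrix Sigma^{-1/2} of the weighted norm. *)
Definition potential (R : realType) (U : Type) n (S : 'M[R]_n)
    (G : U -> 'cV[R]_n) (u : U) (y : 'cV[R]_n) : R :=
  2^-1 * enorm (S *m (y - G u)) ^+ 2.

(* Main.v *)
Require Import Defs.
From HB Require Import structures.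
From mathcomp Require Import all_boot all_order all_algebra.
From mathcomp Require Import all_classical all_reals all_analysis.
From mathcomp Require Import measurable_realfun ess_sup_inf.
From mathcomp Require Import lra.

Set Implicit Arguments.
Unset Strict Implicit.
Unset Printing Implicit Defensive.

Import Order.TTheory GRing.Theory Num.Theory.
Import numFieldNormedType.Exports.

Local Open Scope classical_set_scope.
Local Open Scope ring_scope.
Local Open Scope charge_scope.

(** The law of [(u, delta)] has a density. Given [u = v], the datum
    [delta = G v + vartheta] is a translate of the noise, so for every
    nonnegative measurable [h], independence, Tonelli's theorem and the
    translation invariance of Lebesgue measure give
      [E h(u, delta) = int_y int_v h(v, y) rho(y - G v) dgamma(v) dy],
    where [rho] is the density of the noise ([expectation_joint]). Testing the
    defining property of the conditional distribution on [u in A, delta in B]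
    yields, for each [A] and almost every [y],
      [post y A * evidence y = int_A rho(y - G v) dgamma(v)],
    with an exceptional null set that depends on [A]
    ([post_likelihood_mass_ae]). The sigma-algebra of [U] is generated by a
    countable family closed under intersections ([Uspace_measurableE]), so one
    null set serves all generators, and then all measurable sets because two
    finite measures that agree on such a family are equal
    ([posterior_density_ae]). Thus [post y] has density
    [rho(y - G v) / evidence y] with respect to [gamma], and uniqueness of
    densities identifies it with the Radon-Nikodym derivative
    ([bayes_formula]). For Gaussian noise [rho(y - G v)] is
    [exp(- Phi(v, y))] times a positive constant, which cancels.

    All of this requires [G] to be measurable for the trace of the product
    sigma-algebra, which follows from the representation of the travel time. Let
    [wdist u v = sum_i |u_i - v_i| b_i]. As the [L^oo] norm of [psi_i] is
    [b_i] and [s_* >= 0], the slowness satisfies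
    [s(x, u) <= exp(wdist u v) s(x, v)] for almost every [x] in the domain,
    hence by continuity everywhere on its closure ([slowness_lipschitz]).
    Integrating along curves and taking infima transfers the inequality to the
    travel time ([travel_time_le_scaled]). Finally, a function [F] with
    [F u <= exp(wdist u v) F v] is an infimum, over the countable [wdist]-dense
    set of finitely supported rational sequences [q], of the measurable
    functions [u |-> exp(wdist u q) F q] ([measurable_wdist_lipschitz]). *)

(** * Measurability of matrix operations *)

Lemma measurable_preimage d1 d2 (T1 : measurableType d1)
    (T2 : measurableType d2) (f : T1 -> T2) (A : set T2) :
  measurable_fun setT f -> measurable A -> measurable (f @^-1` A).
Proof. by move=> mf mA; rewrite -[X in measurable X]setTI; exact: mf. Qed.

Section matrix_measurability.
Context {R : realType}.

Lemma measurable_addmx d (T : measurableType d) n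
    (f g : T -> 'cV[R]_n) :
  measurable_fun setT f -> measurable_fun setT g ->
  measurable_fun setT (fun x => f x + g x).
Proof.
move=> mf mg; apply: measurable_fun_mxP => i j.
under eq_fun do rewrite mxE; apply: measurable_funD.
  exact: (measurableT_comp (measurable_mx_entry i j) mf).
exact: (measurableT_comp (measurable_mx_entry i j) mg).
Qed.

Lemma measurable_oppmx d (T : measurableType d) n
    (f : T -> 'cV[R]_n) :
  measurable_fun setT f -> measurable_fun setT (fun x => - f x).
Proof.
move=> mf; apply: measurable_fun_mxP => i j.
under eq_fun do rewrite mxE; apply: measurableT_comp => //.
exact: (measurableT_comp (measurable_mx_entry i j) mf).
Qed.

Lemma measurable_addl_mx n (a : 'cV[R]_n) :
  measurable_fun setT (fun v : 'cV[R]_n => a + v).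
Proof. by apply: measurable_addmx => //; exact: measurable_cst. Qed.

Lemma measurable_mulmx m n (S : 'M[R]_(m, n)) :
  measurable_fun setT (fun v : 'cV[R]_n => S *m v).
Proof.
apply: measurable_fun_mxP => i j; under eq_fun do rewrite mxE.
apply: measurable_sum => k; apply: measurable_funM.
  exact: measurable_cst.
exact: measurable_mx_entry.
Qed.

Lemma enorm_ge0 n (v : 'cV[R]_n) : 0 <= enorm v.
Proof. exact: sqrtr_ge0. Qed.

Lemma measurable_fun_enorm d (T : measurableType d) (A : set T) n
    (f : T -> 'cV[R]_n) :
  (forall i, measurable_fun A (fun r => f r i ord0)) ->
  measurable_fun A (fun r => enorm (f r)).
Proof.
move=> mf; apply: (measurableT_comp (f := @Num.sqrt R)
  (g := fun r => dotv (f r) (f r))).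
  by apply: continuous_measurable_fun => x; exact: sqrt_continuous.
by apply: measurable_sum => i; exact: measurable_funM.
Qed.

End matrix_measurability.

(** * Lebesgue measure on column vectors *)

Lemma vcons_lift0 (R : realType) n (p : measurableTypeR R * 'cV[R]_n) :
  vcons p ord0 ord0 = p.1.
Proof. by rewrite mxE unlift_none. Qed.

Lemma vcons_liftS (R : realType) n (p : measurableTypeR R * 'cV[R]_n) i :
  vcons p (lift ord0 i) ord0 = p.2 i ord0.
Proof. by rewrite mxE liftK. Qed.

Lemma lebesgue_measure_translate (R : realType) (a : R) (A : set R) :
  measurable A ->
  pushforward (@lebesgue_measure R)
    ((fun x => a + x) : measurableTypeR R -> measurableTypeR R) A =
  lebesgue_measure A.
Proof.
have ma : measurable_fun setT
    ((fun x => a + x) : measurableTypeR R -> measurableTypeR R).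
  by apply: measurable_funD => //; exact: measurable_cst.
move=> mA; apply/esym/lebesgue_measure_unique => //= _ [[l r]] _ <-.
rewrite /pushforward.
rewrite (_ : _ @^-1` _ = `]l - a, r - a]%classic); last first.
  by apply/seteqP; split => x /=; rewrite !in_itv/= ltrBlDl lerBrDl.
by rewrite !lebesgue_measure_itv/= !lte_fin ltrD2r -!EFinB opprB addrA subrK.
Qed.

(** By induction on the dimension: a translation acts on the two factors of
    [vcons] separately, and the product measure is determined by rectangles. *)
Lemma lebesgue_vec_translate (R : realType) n (a : 'cV[R]_n)
    (A : set 'cV[R]_n) :
  measurable A ->
  pushforward (lebesgue_vec n) (fun v => a + v) A = lebesgue_vec n A.
Proof.
elim: n a A => [|n IHn] a A mA.
  congr (lebesgue_vec 0 _); apply/seteqP.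
  by split => v /=; rewrite (flatmx0 (a + v)) (flatmx0 v).
rewrite /pushforward /= /lebesgue_vcons /pushforward.
pose f1 : measurableTypeR R -> measurableTypeR R := fun x => a ord0 ord0 + x.
pose a' : 'cV[R]_n := \col_i a (lift ord0 i) ord0.
pose f (p : measurableTypeR R * 'cV[R]_n) := (f1 p.1, a' + p.2).
have mf1 : measurable_fun setT f1.
  by apply: measurable_funD => //; exact: measurable_cst.
have mf : measurable_fun setT f.
  apply: measurable_fun_pair; first exact: measurableT_comp.
  by apply: measurableT_comp => //; exact: measurable_addl_mx.
have mvA : measurable (@vcons R n @^-1` A).
  by apply: measurable_preimage => //; exact: measurable_vcons.
have -> : @vcons R n @^-1` ((fun v => a + v) @^-1` A) =
    f @^-1` (@vcons R n @^-1` A).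
  apply/seteqP; split => p /=; rewrite (_ : vcons (f p) = a + vcons p)//;
  by apply/matrixP => i j; rewrite ord1 !mxE; case: unliftP => [k|] -> /=;
    rewrite ?mxE.
apply/esym.
apply: (@product_measure_unique _ _ _ _ _ (@lebesgue_measure R)
  (lebesgue_vec n)
  (pushforward (lebesgue_measure \x lebesgue_vec n)%E f)) => //.
move=> B C mB mC /=; rewrite /pushforward.
rewrite (_ : f @^-1` _ = (f1 @^-1` B) `*` ((fun v => a' + v) @^-1` C))//.
rewrite product_measure1E//; last 2 first.
- exact: measurable_preimage.
- by apply: measurable_preimage => //; exact: measurable_addl_mx.
by congr (_ * _)%E; [exact: lebesgue_measure_translate|exact: IHn].
Qed.

Definition box (R : realType) n (x : 'cV[R]_n) (e : R) : set 'cV[R]_n :=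
  [set v | forall i, x i ord0 - e < v i ord0 < x i ord0 + e].

Lemma lebesgue_vec_box (R : realType) n (x : 'cV[R]_n) (e : R) : 0 < e ->
  measurable (box x e) /\ (0 < lebesgue_vec n (box x e))%E.
Proof.
move=> e0; have mB m (y : 'cV[R]_m) : measurable (box y e).
  rewrite (_ : box y e = \bigcap_(i in [set: 'I_m])
      ((fun v : 'cV[R]_m => (v i ord0 : measurableTypeR R)) @^-1`
         `]y i ord0 - e, y i ord0 + e[%classic)).
    apply: fin_bigcap_measurable => [|i _]; first exact: finite_finset.
    apply: measurable_preimage; first exact: measurable_mx_entry.
    exact: measurable_itv.
  apply/seteqP; split => v h i; last by have := h i I; rewrite /= in_itv.
  by move=> _ /=; rewrite in_itv; exact: h.
split=> //; elim: n x => [|k IHk] x.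
  have -> : box x e = setT by apply/seteqP; split => // v _ [].
  by rewrite /= diracT lte01.
rewrite /= /lebesgue_vcons /pushforward.
pose x' : 'cV[R]_k := \col_i x (lift ord0 i) ord0.
rewrite (_ : _ @^-1` _ =
    `]x ord0 ord0 - e, x ord0 ord0 + e[%classic `*` box x' e); last first.
  apply/seteqP; split => -[y v] /=.
    move=> h; split => [|i].
      by have := h ord0; rewrite vcons_lift0 in_itv.
    by have := h (lift ord0 i); rewrite vcons_liftS !mxE.
  case; rewrite in_itv/= => h1 h2 i; case: (unliftP ord0 i) => [j|] ->.
    by have := h2 j; rewrite vcons_liftS !mxE.
  by rewrite vcons_lift0.
rewrite product_measure1E; [|exact: measurable_itv|exact: mB].
rewrite mule_gt0//.
suff : (0 < lebesgue_measure
    `](x ord0 ord0 - e)%R, (x ord0 ord0 + e)%R[%classic)%E.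
  exact.
rewrite lebesgue_measure_itv.
rewrite /= lte_fin; have -> : x ord0 ord0 - e < x ord0 ord0 + e by lra.
rewrite -EFinB lte_fin; lra.
Qed.

Lemma near_box (R : realType) n (x : 'cV[R]_n) (A : set 'cV[R]_n) :
  nbhs x A -> exists2 e, 0 < e & box x e `<=` A.
Proof.
case/nbhs_ballP => e /= e0 xA; exists e => // v xv; apply: xA.
split=> // i j; rewrite ord1 /ball/= ltr_distlC.
exact: xv.
Qed.

(** Nonempty open sets have positive measure, so a property that holds almost
    everywhere in an open set holds on a dense subset of its closure. *)
Lemma ae_dense (R : realType) n (D : set 'cV[R]_n) (Q : 'cV[R]_n -> Prop)
    (x : 'cV[R]_n) (V : set 'cV[R]_n) :
  open D -> (\forall y \ae lebesgue_vec n, D y -> Q y) ->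
  closure D x -> nbhs x V -> exists y, [/\ D y, V y & Q y].
Proof.
move=> oD [M [mM M0 QM]] Dx xV.
have [y [Dy Vy]] := Dx _ (nbhs_interior xV).
have : nbhs y (D `&` V) by apply: filterI => //; exact: open_nbhs_nbhs.
case/near_box => e e0 ySub; apply: contrapT => /forallNP none.
have [mB] := lebesgue_vec_box y e0; rewrite ltNge => /negP; apply.
rewrite -M0; apply: le_measure; rewrite ?inE// => z /ySub [Dz Vz].
by apply: QM => /= /(_ Dz) Qz; apply: (none z).
Qed.

(** * Measurability from multiplicative Lipschitz bounds *)

Section weighted_distance.
Context {R : realType} (b : nat -> R).
Hypothesis b_ge0 : forall i, 0 <= b i.
Implicit Types u v w : Uspace b.

Definition wdist (u v : Uspace b) : R :=
  limn (series (fun i => `|Ucoord u i - Ucoord v i| * b i)).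

Lemma wdist_term_ge0 u v i : 0 <= `|Ucoord u i - Ucoord v i| * b i.
Proof. by rewrite mulr_ge0. Qed.

Lemma is_cvg_Ucoord u : cvgn (series (fun i => `|Ucoord u i| * b i)).
Proof. exact: (svalP u). Qed.

Lemma is_cvg_wdist u v :
  cvgn (series (fun i => `|Ucoord u i - Ucoord v i| * b i)).
Proof.
have := is_cvg_seriesD (@is_cvg_Ucoord u) (@is_cvg_Ucoord v).
apply: series_le_cvg => i; first exact: wdist_term_ge0.
- by rewrite addr_ge0// mulr_ge0.
- by rewrite /GRing.add/= -mulrDl ler_wpM2r// ler_normB.
Qed.

Lemma wdist_ge0 u v : 0 <= wdist u v.
Proof.
apply: limr_ge; first exact: is_cvg_wdist.
by apply: nearW => n; apply: sumr_ge0 => i _; exact: wdist_term_ge0.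
Qed.

Lemma wdistC u v : wdist u v = wdist v u.
Proof.
by congr (limn (series _)); apply/funext => i; rewrite distrC.
Qed.

Lemma measurable_Ucoord i :
  measurable_fun setT (fun u : Uspace b => Ucoord u i).
Proof.
move=> _ B mB; rewrite setTI; exists ((fun u : Rinf R => u i) @^-1` B).
  apply: sub_sigma_algebra; exists i => //; exists B => //.
  by rewrite setTI.
by rewrite setTI.
Qed.

Lemma measurable_wdist v : measurable_fun setT (wdist ^~ v).
Proof.
apply: (@measurable_fun_cvg _ _ _ _
  (fun n u => series (fun i => `|Ucoord u i - Ucoord v i| * b i) n)).
  move=> n; rewrite /series/=; apply: measurable_sum => i.
  apply: measurable_funM; last exact: measurable_cst.
  apply: measurableT_comp; first exact: normr_measurable.
  by apply: measurable_funB; [exact: measurable_Ucoord|exact: measurable_cst].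
by move=> u _; exact: is_cvg_wdist.
Qed.

Definition ratseq_fun (l : seq rat) (i : nat) : R := ratr (nth 0 l i).

Lemma Uset_ratseq l : Uset b (ratseq_fun l).
Proof.
rewrite /Uset/=; apply/cvg_ex.
exists (series (fun i => `|ratseq_fun l i| * b i) (size l)).
apply: cvg_near_cst; near=> n.
apply/eqP; rewrite -subr_eq0; apply/eqP; rewrite sub_series_geq; last first.
  by near: n; exact: nbhs_infty_ge.
rewrite big_nat_cond big1// => i /andP[/andP[li _] _].
by rewrite /ratseq_fun nth_default// raddf0 normr0 mul0r.
Unshelve. all: by end_near. Qed.

Definition ratseq (l : seq rat) : Uspace b :=
  exist _ (ratseq_fun l) (@Uset_ratseq l).

(** Cut [u] where the tail of [sum_i |u_i| b_i] is below [e / 4], and spend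
    another [e / 4] on rational approximations of the finitely many coordinates
    that remain. *)
Lemma ratseq_dense u (e : R) : 0 < e -> exists l, wdist u (ratseq l) < e.
Proof.
move=> e0; have cu := @is_cvg_Ucoord u.
have e4 : 0 < e / 4 by lra.
pose S := series (fun i => `|Ucoord u i| * b i).
have [n _ hn] : \forall n \near \oo, `|limn S - S n| < e / 4.
  exact: (@cvgr_dist_lt _ _ _ _ _ S _ cu).
have ndS : {homo S : n m / (n <= m)%N >-> n <= m}.
  by apply: nondecreasing_series => i _ _; rewrite mulr_ge0.
(* [b i + 1] stands in for [b i], which may vanish, and [n.+1] for [n]. *)
pose del i := e / 4 / n.+1%:R / (b i + 1).
have del0 i : 0 < del i.
  by rewrite /del !divr_gt0// ltr_wpDl.
have /choice[r hr] : forall i, exists q : rat,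
    ratr q \in `]Ucoord u i - del i, Ucoord u i + del i[.
  by move=> i; apply: rat_in_itvoo; have := del0 i; lra.
exists (mkseq r n).
apply: (@le_lt_trans _ _ (e / 4 + e / 4)); last lra.
apply: limr_le; first exact: is_cvg_wdist.
near=> m.
have nm : (n <= m)%N by near: m; exact: nbhs_infty_ge.
rewrite /series/= (big_cat_nat _ nm)//=; apply: lerD.
  apply: (@le_trans _ _ (\sum_(0 <= i < n) (e / 4 / n.+1%:R))); last first.
    rewrite sumr_const_nat subn0 -[_ *+ n]mulr_natr -(mulrA (e / 4)).
    rewrite ler_piMr ?(ltW e4)//.
    by rewrite ler_pdivrMl ?mulr1 ?ler_nat.
  rewrite big_nat_cond [leRHS]big_nat_cond.
  apply: ler_sum => i /andP[/andP[_ ni] _].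
  rewrite /Ucoord /useq /= /ratseq_fun nth_mkseq//.
  have := hr i; rewrite in_itv/= -ltr_distlC => /ltW hri.
  apply: (@le_trans _ _ (del i * b i)); first exact: ler_wpM2r.
  rewrite /del -(mulrA (e / 4 / _)) ler_piMr//; first by rewrite divr_ge0// ltW.
  by rewrite ler_pdivrMl ?ltr_wpDl// mulr1 lerDl.
rewrite (_ : \sum_(_ <= _ < _) _ = S m - S n); last first.
  rewrite sub_series_geq//; apply: eq_big_nat => i /andP[ni _].
  rewrite {2}/Ucoord /useq /= /ratseq_fun nth_default ?size_mkseq//.
  by rewrite raddf0 subr0.
have := hn n (leqnn n); have := nondecreasing_cvgn_le ndS cu m.
by rewrite /= -/S => h1 /ltr_normlW; lra.
Unshelve. all: by end_near. Qed.

(** Applying the bound twice gives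
    [F u <= exp(wdist u q) F q <= exp(2 wdist u q) F u], so
    [F u < a] exactly when [exp(wdist u q) F q < a] for some [q] in the
    countable dense set; each of these conditions is measurable in [u]. *)
Lemma measurable_wdist_lipschitz (F : Uspace b -> R) :
  (forall u v, F u <= expR (wdist u v) * F v) -> measurable_fun setT F.
Proof.
move=> hF; apply: (measurability _ (RGenInftyO.measurableE R)).
move=> _ [_ [a ->] <-]; rewrite setTI.
rewrite (_ : _ @^-1` _ = \bigcup_(l : seq rat)
    ((fun u => expR (wdist u (ratseq l)) * F (ratseq l))
       @^-1` `]-oo, a[%classic)).
  apply: countable_bigcupT_measurable => // l.
  rewrite -[X in measurable X]setTI.
  apply: (measurable_funM (f := fun u => expR (wdist u (ratseq l)))
    (g := fun=> F (ratseq l))) => //.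
  by apply: measurableT_comp => //; exact: measurable_wdist.
apply/seteqP; split => u /=; rewrite in_itv/=; last first.
  by move=> [l _ /=]; rewrite in_itv/=; exact/le_lt_trans/hF.
move=> Fua.
have [e e0 he] : exists2 e, 0 < e & forall t, 0 <= t <= e -> expR t * F u < a.
  have : (fun t : R => expR t * F u) x @[x --> (0 : R)] --> expR 0 * F u.
    by apply: cvgM; [exact: continuous_expR|exact: cvg_cst].
  rewrite expR0 mul1r => /cvgr_lt/(_ a Fua)/nbhs_ballP[e /= e0 he].
  exists (e / 2) => [|t /andP[t0 te]]; first by rewrite divr_gt0.
  apply: (he t); rewrite /ball/= sub0r normrN ger0_norm//.
  by apply: le_lt_trans te _; rewrite /= in e0; lra.
have [l hl] := @ratseq_dense u (e / 2) (divr_gt0 e0 (ltr0n _ 2)).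
exists l => //=; rewrite in_itv/=.
have d0 := wdist_ge0 u (ratseq l).
apply: le_lt_trans (he (wdist u (ratseq l) + wdist u (ratseq l)) _).
  rewrite expRD -mulrA ler_wpM2l ?expR_ge0//.
  by rewrite wdistC hF.
by apply/andP; split; lra.
Qed.

End weighted_distance.

(** * Dependence of the slowness on the parameter *)

Section slowness.
Context {R : realType} {d : nat}.
Implicit Types D : set 'cV[R]_d.

Lemma Linfty_norm_ae_ub D (f : 'cV[R]_d -> R) : in_Linfty D f ->
  \forall x \ae lebesgue_vec d, D x -> `|f x| <= Linfty_norm D f.
Proof.
move=> /sub_Lfun_finLfun; rewrite inE /= /finite_norm /Linfty_norm => fin.
have : ('N[lebesgue_vec d]_+oo[EFin \o f \_ D] \is a fin_num)%E.
  by rewrite ge0_fin_numE// Lnorm_ge0.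
move=> /fineK; set M := fine _; rewrite unlock; case: ifPn => [_ ME|mu0 _].
  have := ess_sup_ge (lebesgue_vec d) (abse \o (EFin \o f \_ D)).
  apply: filterS => x; rewrite -ME /= lee_fin => + Dx.
  by rewrite patchE mem_set.
exists setT; split => //; apply/eqP; rewrite eq_le measure_ge0 andbT.
by rewrite leNgt.
Qed.

Variables (D : set 'cV[R]_d) (b : nat -> R).
Variables (sstar sbar : 'cV[R]_d -> R) (psi : nat -> 'cV[R]_d -> R).
Variable s : 'cV[R]_d -> Uspace b -> R.
Hypothesis oD : open D.
Hypothesis hpsi : forall i, in_Linfty D (psi i).
Hypothesis hsstar_ge0 : \forall x \ae lebesgue_vec d, D x -> 0 <= sstar x.
Hypothesis hb : forall i, b i = Linfty_norm D (psi i).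
Hypothesis hs : forall u, \forall x \ae lebesgue_vec d, D x ->
  s x u = sstar x +
    expR (sbar x + limn (series (fun i => Ucoord u i * psi i x))).
Hypothesis hs_continuous : forall u, {within closure D, continuous (s ^~ u)}.

Lemma weight_ge0 i : 0 <= b i.
Proof. by rewrite hb fine_ge0// Lnorm_ge0. Qed.

Lemma exponent_lipschitz (u v : Uspace b) x :
  (forall i, `|psi i x| <= b i) ->
  limn (series (fun i => Ucoord u i * psi i x)) <=
  wdist u v + limn (series (fun i => Ucoord v i * psi i x)).
Proof.
move=> hx.
have cv (w : Uspace b) : cvgn (series (fun i => Ucoord w i * psi i x)).
  apply: normed_cvg; apply: series_le_cvg (@is_cvg_Ucoord _ _ w) => i //=.
    by rewrite mulr_ge0// weight_ge0.
  by rewrite normrM ler_wpM2l.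
have cuv := @is_cvg_wdist _ _ weight_ge0 u v.
rewrite -lim_seriesD//; apply: lim_series_le => //.
  exact: is_cvg_seriesD.
move=> i; rewrite /GRing.add/= -lerBlDr -mulrBl.
by rewrite (le_trans (ler_norm _))// normrM ler_wpM2l.
Qed.

(** At a point where all the bounds [|psi_i x| <= b_i] hold, the exponents for
    [u] and [v] differ by at most [wdist u v]; the term [s_*] only helps, as it
    is nonnegative and [exp(wdist u v) >= 1]. Such points are dense in the
    closure of the domain, and both sides are continuous there. *)
Lemma slowness_lipschitz (u v : Uspace b) x : closure D x ->
  s x u <= expR (wdist u v) * s x v.
Proof.
move=> Dx.
have hae : \forall y \ae lebesgue_vec d,
    D y -> s y u <= expR (wdist u v) * s y v.
  have hpb := ae_foralln (fun i => Linfty_norm_ae_ub (hpsi i)).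
  near=> y => Dy.
  have pb : forall i, `|psi i y| <= b i.
    by move=> i; rewrite hb; move: i Dy; near: y; exact: hpb.
  have su : s y u = sstar y +
      expR (sbar y + limn (series (fun i => Ucoord u i * psi i y))).
    by move: Dy; near: y; exact: hs.
  have sv : s y v = sstar y +
      expR (sbar y + limn (series (fun i => Ucoord v i * psi i y))).
    by move: Dy; near: y; exact: hs.
  have s0 : 0 <= sstar y by move: Dy; near: y; exact: hsstar_ge0.
  rewrite su sv mulrDr; apply: lerD.
    by rewrite ler_peMl// -expR0 ler_expR (wdist_ge0 weight_ge0).
  by rewrite -expRD ler_expR addrCA lerD2l exponent_lipschitz.
rewrite leNgt; apply/negP => lt.
pose f y := s y u - expR (wdist u v) * s y v.
have cf : {within closure D, continuous f}.
  move=> y; apply: cvgB; first exact: hs_continuous.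
  by apply: cvgM; [exact: cvg_cst|exact: hs_continuous].
have : \forall y \near within (closure D) (nbhs x), 0 < f y.
  have := cf x; rewrite /continuous_at nbhs_subspace_in//= => cfx.
  by apply: (cvgr_gt _ cfx); rewrite subr_gt0.
move=> nf.
have [y [Dy fy ley]] := ae_dense oD hae Dx nf.
have := fy (subset_closure Dy); rewrite subr_gt0 => /lt_le_trans/(_ ley).
by rewrite ltxx.
Unshelve. all: by end_near. Qed.

End slowness.

(** * Dependence of the travel time on the slowness *)

Section travel_time.
Context {R : realType}.

(** A real-valued integral is [0] when the integral diverges, so a bound of
    [f] by [C g] alone would not suffice; the converse bound makes the two
    integrals finite or infinite together. *)
Lemma Rintegral_le_scaled (D : set R) (f g : R -> R) (C : R) :
  measurable D -> measurable_fun D f -> measurable_fun D g ->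
  (forall r, D r -> 0 <= f r) -> (forall r, D r -> 0 <= g r) -> 0 <= C ->
  (forall r, D r -> f r <= C * g r) -> (forall r, D r -> g r <= C * f r) ->
  \int[lebesgue_measure]_(r in D) f r <=
  C * \int[lebesgue_measure]_(r in D) g r.
Proof.
move=> mD mf mg f0 g0 C0 fg gf.
have le_scaled (h k : R -> R) : measurable_fun D h -> measurable_fun D k ->
    (forall r, D r -> 0 <= h r) -> (forall r, D r -> 0 <= k r) ->
    (forall r, D r -> h r <= C * k r) ->
    (\int[lebesgue_measure]_(r in D) (h r)%:E <=
     C%:E * \int[lebesgue_measure]_(r in D) (k r)%:E)%E.
  move=> mh mk h0 k0 hk; rewrite -ge0_integralZl//.
  - apply: ge0_le_integral => //.
    + exact/measurable_EFinP.
    + apply/measurable_EFinP.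
      by apply: measurable_funM => //; exact: measurable_cst.
  exact/measurable_EFinP.
have If0 : (0 <= \int[lebesgue_measure]_(r in D) (f r)%:E)%E.
  by apply: integral_ge0 => r Dr; rewrite lee_fin f0.
have Ig0 : (0 <= \int[lebesgue_measure]_(r in D) (g r)%:E)%E.
  by apply: integral_ge0 => r Dr; rewrite lee_fin g0.
have := le_scaled _ _ mf mg f0 g0 fg; have := le_scaled _ _ mg mf g0 f0 gf.
rewrite /Rintegral; move: If0 Ig0.
move: (integral _ _ _) (integral _ _ _) => Ig If.
case: If => [If||]//; case: Ig => [Ig||]//= If0 Ig0.
by rewrite mulr0.
Qed.

Context {d : nat} (D : set 'cV[R]_d) (x0 x : 'cV[R]_d).

Lemma measurable_curve_integrand (s : 'cV[R]_d -> R) xi dxi :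
  {within closure D, continuous s} -> admissible_curve D x0 x xi dxi ->
  measurable_fun (`[0, 1]%classic : set R) (fun r => s (xi r) * enorm (dxi r)).
Proof.
move=> cs [cxi Wxi xiD _ _].
apply: measurable_funM.
  apply: subspace_continuous_measurable_fun; first exact: measurable_itv.
  apply/subspace_continuousP => r /= r01.
  have xir : closure D (xi r) by apply: xiD; rewrite in_itv/= in r01.
  move=> A nA.
  have sA : nbhs (xi r) [set y | closure D y -> A (s y)].
    exact: ((subspace_continuousP _ _).1 cs _ xir _ nA).
  have xiA : nbhs r
      [set t | `[0, 1]%classic t -> closure D (xi t) -> A (s (xi t))].
    exact: ((subspace_continuousP _ _).1 cxi _ r01 _ sA).
  suff : nbhs r [set t | `[0, 1]%classic t -> A (s (xi t))] by [].
  apply: filterS xiA => t + t01.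
  by apply=> //; apply: xiD; move: t01; rewrite /= in_itv.
apply: measurable_fun_enorm => i.
have [_ /sub_Lfun_mfun + _] := Wxi i; rewrite inE => mdxi.
exact: (measurable_restrictT _ (measurable_itv _)).2 mdxi.
Qed.

Lemma travel_time_le_scaled (s1 s2 : 'cV[R]_d -> R) (C : R) :
  {within closure D, continuous s1} -> {within closure D, continuous s2} ->
  (forall y, closure D y -> 0 <= s1 y) ->
  (forall y, closure D y -> 0 <= s2 y) ->
  0 < C ->
  (forall y, closure D y -> s1 y <= C * s2 y) ->
  (forall y, closure D y -> s2 y <= C * s1 y) ->
  travel_time D x0 s1 x <= C * travel_time D x0 s2 x.
Proof.
move=> cs1 cs2 s10 s20 C0 s12 s21; rewrite /travel_time.
set S1 := [set t | _]; set S2 := (X in _ <= _ * inf X).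
have [[xi [dxi xiP]]|none] :=
    pselect (exists xi dxi, admissible_curve D x0 x xi dxi); last first.
  (* Without admissible curves both infima are that of the empty set, 0. *)
  have E (S : set R) : S `<=` [set t | exists xi dxi,
      admissible_curve D x0 x xi dxi] -> S = set0.
    by move=> h; apply/seteqP; split => // t /h.
  have -> : S1 = set0 by apply: E => t [xi [dxi [+ _]]] /=; exists xi, dxi.
  have -> : S2 = set0 by apply: E => t [xi [dxi [+ _]]] /=; exists xi, dxi.
  by rewrite inf0 mulr0.
rewrite -ler_pdivrMl//; apply: lb_le_inf.
  by eexists; exists xi, dxi; split => //; exact: xiP.
move=> _ [xi' [dxi' [xiP' ->]]]; rewrite ler_pdivrMl//.
have xiD r : r \in `[0, 1] -> closure D (xi' r).
  by rewrite in_itv/=; case: xiP' => _ _ h _ _; exact: h.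
apply: (@le_trans _ _
    (\int[lebesgue_measure]_(r in `[0, 1]) (s1 (xi' r) * enorm (dxi' r)))).
  apply: ge_inf; last by exists xi', dxi'.
  exists 0 => _ [xi'' [dxi'' [[_ _ h _ _] ->]]].
  apply: fine_ge0; apply: integral_ge0 => r /=; rewrite in_itv/= => /h hr.
  by rewrite lee_fin mulr_ge0 ?enorm_ge0// s10.
apply: Rintegral_le_scaled => //.
- exact: measurable_curve_integrand xiP'.
- exact: measurable_curve_integrand xiP'.
- by move=> r /xiD hr; rewrite mulr_ge0 ?enorm_ge0// s10.
- by move=> r /xiD hr; rewrite mulr_ge0 ?enorm_ge0// s20.
- exact: ltW.
- by move=> r /xiD hr; rewrite mulrA ler_wpM2r ?enorm_ge0// s12.
- by move=> r /xiD hr; rewrite mulrA ler_wpM2r ?enorm_ge0// s21.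
Qed.

End travel_time.

Lemma measurable_travel_time (R : realType) d (D : set 'cV[R]_d) (b : nat -> R)
    (s : 'cV[R]_d -> Uspace b -> R) (x0 x : 'cV[R]_d) :
  (forall i, 0 <= b i) ->
  (forall u, {within closure D, continuous (s ^~ u)}) ->
  (forall u y, closure D y -> 0 <= s y u) ->
  (forall u v y, closure D y -> s y u <= expR (wdist u v) * s y v) ->
  measurable_fun setT (fun u => travel_time D x0 (s ^~ u) x).
Proof.
move=> b0 cs s0 sL; apply: (measurable_wdist_lipschitz b0) => u v.
apply: travel_time_le_scaled => //; first by move=> y; exact: s0.
- by move=> y; exact: s0.
- exact: expR_gt0.
- by move=> y; exact: sL.
- by move=> y Dy; rewrite wdistC; exact: sL.
Qed.

(** * Measures with a density *)

Section density.
Context d (T : measurableType d) (R : realType).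
Local Open Scope ereal_scope.

Section mdensity.
Variables (mu : {measure set T -> \bar R}) (f : T -> \bar R).
Hypotheses (mf : measurable_fun setT f) (f0 : forall x, 0 <= f x).

(** The proofs are arguments so that the measure structure below can be inferred
    from the term. *)
Definition mdensity of measurable_fun setT f & (forall x, 0 <= f x) :=
  fun A : set T => \int[mu]_(x in A) f x.

Let mdensity0 : mdensity mf f0 set0 = 0.
Proof. exact: integral_set0. Qed.

Let mdensity_ge0 A : 0 <= mdensity mf f0 A.
Proof. by apply: integral_ge0 => x _. Qed.

Let mdensity_sigma_additive : semi_sigma_additive (mdensity mf f0).
Proof.
move=> A mA tA mUA; rewrite /mdensity ge0_integral_bigcup//; last first.
  exact: measurable_funTS.
by apply: is_cvg_ereal_nneg_natsum_cond => n _ _; exact: integral_ge0.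
Qed.

HB.instance Definition _ := isMeasure.Build _ _ _ (mdensity mf f0)
  mdensity0 mdensity_ge0 mdensity_sigma_additive.

End mdensity.

Lemma density_dominates (nu mu : {measure set T -> \bar R}) (f : T -> \bar R) :
  measurable_fun setT f ->
  (forall A, measurable A -> nu A = \int[mu]_(x in A) f x) -> nu `<< mu.
Proof.
move=> mf nuE; apply/null_content_dominatesP => A mA muA0.
rewrite nuE//; apply: null_set_integral => //; exact: measurable_funTS.
Qed.

Variables (nu : {finite_measure set T -> \bar R})
  (mu : {sigma_finite_measure set T -> \bar R}) (f : T -> \bar R).
Hypothesis mf : measurable_fun setT f.
Hypothesis nuE : forall A, measurable A -> nu A = \int[mu]_(x in A) f x.

Lemma density_Radon_Nikodym :
  'd (charge_of_finite_measure nu) '/d mu = f %[ae mu].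
Proof.
have numu := density_dominates mf nuE.
apply: integral_ae_eq => //; first exact: Radon_Nikodym_integrable.
by move=> E _ mE; rewrite -Radon_Nikodym_integral//; exact: nuE.
Qed.

(** The change of variables is known for the Radon-Nikodym derivative, which
    agrees with [f] almost everywhere. *)
Lemma ge0_integral_density (h : T -> \bar R) : measurable_fun setT h ->
  (forall x, 0 <= h x) -> \int[nu]_x h x = \int[mu]_x (h x * f x).
Proof.
move=> mh h0; have numu := density_dominates mf nuE.
rewrite -(Radon_Nikodym_SigmaFinite.change_of_variables numu)//.
have iRN := Radon_Nikodym_SigmaFinite.f_integrable numu.
apply: ae_eq_integral => //.
- by apply: emeasurable_funM => //; exact: measurable_int iRN.
- exact: emeasurable_funM.
apply: ae_eqe_mul2l; apply: integral_ae_eq => //.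
by move=> E _ mE; rewrite -nuE// -(Radon_Nikodym_SigmaFinite.f_integral numu).
Qed.

End density.

(** * The formula of Bayes for additive noise with a density *)

Section bayes.
Context {R : realType} dU (U : measurableType dU) dW (W : measurableType dW).
Context (n : nat) (P : probability W R) (gamma : probability U R).
Variables (u : {RV P >-> U}) (eta : {RV P >-> 'cV[R]_n}).
Variables (G : U -> 'cV[R]_n) (rho : 'cV[R]_n -> R).
Hypotheses (mG : measurable_fun setT G) (mrho : measurable_fun setT rho).
Hypothesis rho_gt0 : forall y, 0 < rho y.
Hypothesis hu : forall A, measurable A -> distribution P u A = gamma A.
Hypothesis heta : forall B, measurable B ->
  distribution P eta B = (\int[lebesgue_vec n]_(y in B) (rho y)%:E)%E.
Hypothesis hindep : independent_rv u eta.
Local Open Scope ereal_scope.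

Let delta w := (G (u w) + eta w)%R.

Definition likelihood (p : U * 'cV[R]_n) : R := rho (p.2 - G p.1).

Lemma likelihood_gt0 p : (0 < likelihood p)%R.
Proof. exact: rho_gt0. Qed.

Lemma measurable_likelihood : measurable_fun setT likelihood.
Proof.
apply: measurableT_comp mrho _; apply: measurable_addmx => //.
by apply: measurable_oppmx; apply: measurableT_comp.
Qed.

(** Independence makes the law of [(u, eta)] the product of the two laws;
    the noise is then integrated against its density and, for fixed [v], the
    substitution [y = G v + t] preserves Lebesgue measure. *)
Lemma expectation_joint (h : U * 'cV[R]_n -> \bar R) :
  measurable_fun setT h -> (forall p, 0 <= h p) ->
  \int[P]_w h (u w, delta w) =
  \int[lebesgue_vec n]_y \int[gamma]_v (h (v, y) * (likelihood (v, y))%:E).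
Proof.
move=> mh h0.
pose J w := (u w, eta w).
have mJ : measurable_fun setT J.
  by apply: measurable_fun_pair; exact: measurable_funP.
pose sh (p : U * 'cV[R]_n) := (p.1, G p.1 + p.2)%R.
have msh : measurable_fun setT sh.
  apply: measurable_fun_pair => //; apply: measurable_addmx => //.
  exact: measurableT_comp.
have mhsh : measurable_fun setT (h \o sh) by exact: measurableT_comp.
transitivity (\int[pushforward P J]_p (h \o sh) p).
  by rewrite ge0_integral_pushforward// => y _; exact: h0.
transitivity (\int[(distribution P u \x distribution P eta)%E]_p (h \o sh) p).
  apply: eq_measure_integral => A mA _; apply/esym.
  exact: product_measure_unique.
rewrite fubini_tonelli1//; last by move=> p; exact: h0.
have mhL : measurable_fun setT (fun p => h p * (likelihood p)%:E).
  apply: emeasurable_funM => //; apply/measurable_EFinP.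
  exact: measurable_likelihood.
transitivity (\int[gamma]_v \int[lebesgue_vec n]_y
    (h (v, y) * (likelihood (v, y))%:E)).
  transitivity (\int[gamma]_v fubini_F (distribution P eta) (h \o sh) v).
    by apply: eq_measure_integral => A mA _; exact: hu.
  apply: eq_integral => v _; rewrite /fubini_F.
  have mhv : measurable_fun setT (fun y => (h \o sh) (v, y)).
    exact: measurable_fun_pair2 mhsh.
  rewrite (@ge0_integral_density _ _ _ (distribution P eta) (lebesgue_vec n)
    (EFin \o rho))//.
  - transitivity (\int[lebesgue_vec n]_t
        ((fun y => h (v, y) * (likelihood (v, y))%:E) \o
         (fun t => G v + t)%R) t).
      apply: eq_integral => t _.
      by rewrite /= /likelihood /= addrAC subrr add0r.
    rewrite -(ge0_integral_pushforward (measurable_addl_mx (G v)) _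
      measurableT)//.
    + apply: eq_measure_integral => [|mGv A mA _].
        exact: measurable_addl_mx.
      exact: lebesgue_vec_translate.
    + exact: measurable_fun_pair2 mhL.
    + by move=> y _; rewrite mule_ge0// lee_fin ltW// likelihood_gt0.
  - exact/measurable_EFinP.
  - by move=> y; exact: h0.
rewrite (@fubini_tonelli _ _ _ _ _ gamma (lebesgue_vec n)
  (fun p => h p * (likelihood p)%:E))//.
by move=> p; rewrite mule_ge0// lee_fin ltW// likelihood_gt0.
Qed.

Definition likelihood_mass (A : set U) (y : 'cV[R]_n) : \bar R :=
  \int[gamma]_(v in A) (likelihood (v, y))%:E.

Lemma likelihood_mass_ge0 A y : 0 <= likelihood_mass A y.
Proof.
by apply: integral_ge0 => v _; rewrite lee_fin ltW// likelihood_gt0.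
Qed.

Lemma measurable_likelihoodl y :
  measurable_fun setT (fun v => likelihood (v, y)).
Proof. exact: measurable_fun_pair1 measurable_likelihood. Qed.

Lemma measurable_likelihood_mass A : measurable A ->
  measurable_fun setT (likelihood_mass A).
Proof.
move=> mA.
pose f (p : U * 'cV[R]_n) := (EFin \o likelihood \_ (A `*` setT)) p.
have mf : measurable_fun setT f.
  apply/measurable_EFinP.
  apply/(measurable_restrictT _ _).1; first exact: measurableX.
  by apply: measurable_funTS; exact: measurable_likelihood.
have f0 p : 0 <= f p.
  rewrite /f /= lee_fin patchE; case: ifP => // _.
  by rewrite ltW// likelihood_gt0.
have := measurable_fun_fubini_tonelli_G (m1 := gamma) f mf f0.
apply: eq_measurable_fun => y _.
rewrite /likelihood_mass /fubini_G [RHS]integral_mkcond.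
apply: eq_integral => v _; rewrite /f /= !patchE.
by rewrite in_setX in_setT andbT; case: ifP.
Qed.

Lemma expectation_restrict (f : 'cV[R]_n -> \bar R) A B :
  measurable_fun setT f -> (forall y, 0 <= f y) ->
  measurable A -> measurable B ->
  \int[P]_(w in u @^-1` A `&` delta @^-1` B) f (delta w) =
  \int[lebesgue_vec n]_(y in B) (f y * likelihood_mass A y).
Proof.
move=> mf f0 mA mB.
pose h (p : U * 'cV[R]_n) := ((f \o snd) \_ (A `*` B)) p.
rewrite integral_mkcond.
transitivity (\int[P]_w h (u w, delta w)).
  by apply: eq_integral => w _; rewrite /h !patchE in_setX in_setI.
rewrite expectation_joint; last 2 first.
- apply/(measurable_restrictT _ _).1; first exact: measurableX.
  by apply: measurable_funTS; apply: (measurableT_comp (f := f) (g := snd)).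
- by move=> p; rewrite /h patchE; case: ifP => // _; exact: f0.
rewrite [RHS]integral_mkcond; apply: eq_integral => y _.
rewrite patchE; case: ifPn => yB; last first.
  apply: integral0_eq => v _.
  by rewrite /h patchE in_setX /= (negbTE yB) andbF mul0e.
rewrite /likelihood_mass -ge0_integralZl//; last 2 first.
- apply/measurable_EFinP; apply: measurable_funTS.
  exact: measurable_likelihoodl.
- by move=> v _; rewrite lee_fin ltW// likelihood_gt0.
rewrite [RHS]integral_mkcond; apply: eq_integral => v _.
rewrite /h !patchE in_setX /= yB andbT; case: ifP => // _.
by rewrite mul0e.
Qed.

Lemma measurable_delta : measurable_fun setT delta.
Proof.
apply: measurable_addmx; last exact: measurable_funP.
apply: measurableT_comp => //; exact: measurable_funP.
Qed.

Lemma joint_law A B : measurable A -> measurable B ->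
  P (u @^-1` A `&` delta @^-1` B) =
  \int[lebesgue_vec n]_(y in B) likelihood_mass A y.
Proof.
move=> mA mB; have := @expectation_restrict (cst 1) A B _ _ mA mB.
rewrite integral_cst ?mul1e; last first.
  apply: measurableI; last exact: measurable_preimage measurable_delta mB.
  by apply: measurable_preimage => //; exact: measurable_funP.
by move=> -> //; apply: eq_integral => y _; rewrite mul1e.
Qed.

Lemma law_delta B : measurable B ->
  pushforward P delta B = \int[lebesgue_vec n]_(y in B) likelihood_mass setT y.
Proof.
by move=> /(joint_law measurableT); rewrite preimage_setT setTI.
Qed.

Variable post : 'cV[R]_n -> probability U R.
Hypothesis hpost : regular_conditional_distribution u delta post.

(** Both sides have the same integral over every measurable set [E], namely the
    probability that [u] is in [A] and the datum in [E]: on the left by the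
    joint law, on the right by the defining property of [post] and the law of
    the datum. *)
Lemma post_likelihood_mass_ae A : measurable A ->
  \forall y \ae lebesgue_vec n,
    likelihood_mass A y = post y A * likelihood_mass setT y.
Proof.
move=> mA; have [mpost postE] := hpost.
have mLA := measurable_likelihood_mass mA.
have mLT := measurable_likelihood_mass measurableT.
suff : ae_eq (lebesgue_vec n) setT (likelihood_mass A)
    (fun y => post y A * likelihood_mass setT y).
  by apply: filterS => y; apply.
apply: integral_ae_eq => //.
- apply/integrableP; split=> //.
  under eq_integral do rewrite gee0_abs ?likelihood_mass_ge0//.
  rewrite -joint_law//; apply: le_lt_trans (ltry 1).
  apply: probability_le1; rewrite preimage_setT setIT.
  exact: measurable_preimage.
- by apply: emeasurable_funM => //; exact: mpost.
move=> E _ mE; rewrite -joint_law// postE//.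
have := @expectation_restrict (fun y => post y A) setT E (mpost _ mA) _
  measurableT mE.
by rewrite preimage_setT setTI => ->.
Qed.

Variable M : R.
Hypothesis rho_le : forall y, (rho y <= M)%R.
Variables (K : countType) (C : K -> set U).
Hypotheses (mC : measurable = <<s range C >>) (CI : setI_closed (range C)).
Hypothesis CT : range C setT.

Definition evidence (y : 'cV[R]_n) : R := (\int[gamma]_v likelihood (v, y))%R.

Lemma evidenceE y : likelihood_mass setT y = (evidence y)%:E.
Proof.
suff fin : likelihood_mass setT y \is a fin_num by rewrite -[LHS]fineK.
rewrite ge0_fin_numE ?likelihood_mass_ge0//.
apply: (@le_lt_trans _ _ (\int[gamma]_v M%:E)); last first.
  rewrite integral_cst// (_ : _ * _ = M%:E) ?ltry//.
  by rewrite -[RHS]mule1; congr (_ * _); exact: probability_setT.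
apply: ge0_le_integral => //.
- by move=> v _; rewrite lee_fin ltW// likelihood_gt0.
- by apply/measurable_EFinP; exact: measurable_likelihoodl.
- by move=> v _; rewrite lee_fin rho_le.
Qed.

(** A positive function with vanishing integral would vanish almost everywhere,
    which is impossible on a space of mass one. *)
Lemma evidence_gt0 y : (0 < evidence y)%R.
Proof.
have mL : measurable_fun setT (fun v => (likelihood (v, y))%:E).
  by apply/measurable_EFinP; exact: measurable_likelihoodl.
have ev_ge0 : (0 <= evidence y)%R.
  by rewrite -lee_fin -evidenceE likelihood_mass_ge0.
rewrite lt_neqAle ev_ge0 andbT eq_sym; apply/eqP => ev0.
have L0 : ae_eq gamma setT (fun v => (likelihood (v, y))%:E) (cst 0).
  apply/(ae_eq_integral_abs gamma measurableT mL).
  under eq_integral => v _ do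
    rewrite gee0_abs ?lee_fin ?(ltW (likelihood_gt0 _))//.
  by rewrite -[LHS]/(likelihood_mass setT y) evidenceE ev0.
have [N [mN N0 LN]] := L0.
have : gamma setT = 0.
  apply/eqP; rewrite eq_le measure_ge0 andbT -N0.
  apply: le_measure; rewrite ?inE//.
  move=> v _; apply: LN => /= /(_ I) [L0v].
  by have := likelihood_gt0 (v, y); rewrite L0v ltxx.
by rewrite probability_setT => /eqP; rewrite onee_eq0.
Qed.

(** The countably many exceptional sets of the generators are merged into one
    Lebesgue null set, which is also null for the law of the datum since that
    law has a density. Off it, the two finite measures agree on a generating
    family closed under intersections, hence everywhere. *)
Lemma posterior_density_ae :
  \forall y \ae pushforward P delta, forall A, measurable A ->
    post y A = \int[gamma]_(v in A) ((evidence y)^-1 * likelihood (v, y))%:E.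
Proof.
have mCi i : measurable (C i).
  by rewrite mC; apply: sub_sigma_algebra; exists i.
have : \forall y \ae lebesgue_vec n, forall i,
    likelihood_mass (C i) y = post y (C i) * likelihood_mass setT y.
  pose good_at i y :=
    likelihood_mass (C i) y = post y (C i) * likelihood_mass setT y.
  have : \forall y \ae lebesgue_vec n, forall k,
      if unpickle k is Some i then good_at i y else True.
    apply: ae_foralln => k; case: unpickle => [i|]; last exact: nearW.
    exact: post_likelihood_mass_ae.
  by apply: filterS => y hy i; have := hy (pickle i); rewrite pickleK.
move=> [N [mN N0 goodN]]; exists N; split=> //.
  rewrite law_delta//; apply: null_set_integral => //.
  apply: measurable_funTS; exact: measurable_likelihood_mass measurableT.
apply: subset_trans goodN => y; apply: contra_not => good A mA.
have ev0 := evidence_gt0 y.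
pose f v := ((evidence y)^-1 * likelihood (v, y))%:E.
have mf : measurable_fun setT f.
  apply/measurable_EFinP; apply: measurable_funM; first exact: measurable_cst.
  exact: measurable_likelihoodl.
have f0 v : 0 <= f v.
  by rewrite lee_fin mulr_ge0// ?invr_ge0 ltW// likelihood_gt0.
apply: (@measure_unique _ R U (range C) (fun=> setT) mC CI _ _
  (post y) (mdensity gamma mf f0)) => //.
- by apply/seteqP; split => // v _; exists 0%N.
- move=> _ [i _ <-].
  suff : post y (C i) = \int[gamma]_(v in C i) f v by [].
  rewrite /f; under eq_integral do rewrite EFinM.
  rewrite ge0_integralZl//; last 3 first.
  + apply/measurable_EFinP; apply: measurable_funTS.
    exact: measurable_likelihoodl.
  + by move=> v _; rewrite lee_fin ltW// likelihood_gt0.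
  + by rewrite lee_fin invr_ge0 ltW.
  rewrite -/(likelihood_mass (C i) y) good evidenceE muleCA -EFinM.
  by rewrite mulVf ?mule1// gt_eqF.
- by move=> k; apply: le_lt_trans (ltry 1); exact: probability_le1.
Qed.

Theorem bayes_formula :
  \forall y \ae pushforward P delta,
    [/\ post y `<< gamma, (0 < evidence y)%R &
        'd (charge_of_finite_measure (post y)) '/d gamma
          = (fun v => ((evidence y)^-1 * likelihood (v, y))%:E) %[ae gamma]].
Proof.
have [N [mN N0 goodN]] := posterior_density_ae.
exists N; split => //; apply: subset_trans goodN => y.
apply: contra_not => good.
have mf : measurable_fun setT
    (fun v => ((evidence y)^-1 * likelihood (v, y))%:E).
  apply/measurable_EFinP; apply: measurable_funM; first exact: measurable_cst.
  exact: measurable_likelihoodl.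
split; [exact: density_dominates mf good|exact: evidence_gt0|].
exact: density_Radon_Nikodym mf good.
Qed.

End bayes.

(** * A countable generating family for the parameter space *)

Section countable_generation.
Context {R : realType} (b : nat -> R).

(** Lists of constraints are countably many, and concatenating two of them
    intersects the sets that they describe. *)
Definition lower_orthant (l : seq (nat * rat)) : set (Uspace b) :=
  [set u | forall iq, iq \in l -> Ucoord u iq.1 < ratr iq.2].

Lemma lower_orthant_setI_closed : setI_closed (range lower_orthant).
Proof.
move=> _ _ [l _ <-] [m _ <-]; exists (l ++ m) => //.
apply/seteqP; split => u /=.
  by move=> h; split => iq iqP; apply: h; rewrite mem_cat iqP ?orbT.
by move=> [hl hm] iq; rewrite mem_cat => /orP[/hl|/hm].
Qed.

Lemma range_lower_orthantT : range lower_orthant setT.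
Proof. by exists [::] => //; apply/seteqP; split. Qed.

(** For the inclusion from left to right, the coordinates are measurable for the
    sigma-algebra generated by the orthants, since [u_i < a] means [u_i < q] for
    some rational [q < a]; hence so is the embedding into the product. *)
Lemma Uspace_measurableE :
  @measurable _ (Uspace b) = <<s range lower_orthant >>.
Proof.
apply/seteqP; split; last first.
  apply: smallest_sub; first exact: sigma_algebra_measurable.
  move=> _ [l _ <-].
  rewrite (_ : lower_orthant l = \bigcap_(iq in [set` l])
      ((fun u => Ucoord u iq.1) @^-1` `]-oo, ratr iq.2[%classic)).
    apply: fin_bigcap_measurable => [|[i q] _]; first exact: finite_seq.
    rewrite -[X in measurable X]setTI.
    by apply: measurable_Ucoord.
  by apply/seteqP; split => u /= h iq iql; have := h iq iql; rewrite /= in_itv.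
pose V := g_sigma_algebraType (range lower_orthant).
have mcoord i :
    measurable_fun setT (fun u : V => Ucoord u i : measurableTypeR R).
  apply: (measurability _ (RGenInftyO.measurableE R)).
  move=> _ [_ [a ->] <-]; rewrite setTI.
  rewrite (_ : _ @^-1` _ = \bigcup_(q : rat)
      (if ratr q < a then lower_orthant [:: (i, q)] else set0)).
    apply: (@countable_bigcupT_measurable _ V) => // q.
    case: ifP => _; last exact: measurable0.
    by apply: sub_sigma_algebra; exists [:: (i, q)].
  apply/seteqP; split => u /=; rewrite in_itv/=.
    move=> /rat_in_itvoo[q]; rewrite in_itv/= => /andP[uq qa].
    by exists q => //=; rewrite qa => iq; rewrite inE => /eqP ->.
  move=> [q _]; case: ifP => // qa /(_ (i, q)).
  by rewrite inE eqxx => /(_ isT)/lt_trans; exact.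
have museq : measurable_fun setT (fun u : V => useq u : Rinf R).
  apply: (@measurability _ _ V (Rinf R) setT _
    (\bigcup_(i : nat) preimage_set_system setT
       (fun u : nat -> R => (u i : measurableTypeR R)) measurable)) => //.
  move=> _ [_ [i _ [B mB <-]] <-]; rewrite !setTI.
  by have := mcoord i measurableT B mB; rewrite setTI.
by move=> _ [B mB <-]; exact: museq.
Qed.

End countable_generation.

(** * The Gaussian density *)

Section gaussian.
Context {R : realType} {n : nat}.
Implicit Types (A S : 'M[R]_n) (v : 'cV[R]_n).

Lemma dotvE v w : dotv v w = (v^T *m w) ord0 ord0.
Proof. by rewrite mxE; apply: eq_bigr => i _; rewrite mxE. Qed.

(** Moving the symmetric factor [S] across the inner product leaves
    [S *m S = invmx A]. *)
Lemma enorm_inv_sqrtmx A S v : is_inv_sqrtmx A S ->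
  enorm (S *m v) ^+ 2 = dotv v (invmx A *m v).
Proof.
move=> [[ST _] SS]; rewrite /enorm sqr_sqrtr; last first.
  by apply: sumr_ge0 => i _; rewrite -expr2 sqr_ge0.
by rewrite !dotvE trmx_mul ST -mulmxA (mulmxA S) SS.
Qed.

Definition gaussian_const A : R := (Num.sqrt ((2 * pi) ^+ n * \det A))^-1.

Lemma gaussian_pdfE A S v : is_inv_sqrtmx A S ->
  gaussian_pdf A v = gaussian_const A * expR (- (2^-1 * enorm (S *m v) ^+ 2)).
Proof.
move=> hS; rewrite (enorm_inv_sqrtmx _ hS) /gaussian_pdf /gaussian_const.
by congr (_ * expR _); rewrite mulNr mulrC.
Qed.

(** If the constant were [0], the density would integrate to [0]; this avoids
    computing the sign of the determinant. *)
Lemma gaussian_const_gt0 d (T : measurableType d) (P : probability T R) A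
    (X : {RV P >-> 'cV[R]_n}) :
  has_gaussian_law A X -> 0 < gaussian_const A.
Proof.
move=> hX; rewrite lt_neqAle invr_ge0 sqrtr_ge0 andbT eq_sym.
apply/eqP => C0; have := hX setT measurableT.
rewrite (_ : (\int[_]_(v in _) _)%E = 0%E).
  by rewrite probability_setT => /eqP; rewrite onee_eq0.
apply: integral0_eq => v _.
by rewrite /gaussian_pdf -/(gaussian_const A) C0 mul0r.
Qed.

Lemma measurable_gaussian_pdf A S : is_inv_sqrtmx A S ->
  measurable_fun setT (gaussian_pdf A).
Proof.
move=> hS; rewrite (funext (fun v => gaussian_pdfE v hS)).
apply: measurable_funM; first exact: measurable_cst.
apply: measurableT_comp; first exact: measurable_expR.
apply: measurableT_comp; first exact: oppr_measurable.
apply: measurable_funM; first exact: measurable_cst.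
apply: measurable_funX; apply: measurable_fun_enorm => i.
exact: (measurableT_comp (measurable_mx_entry i ord0) (measurable_mulmx S)).
Qed.

End gaussian.

(** * The posterior of the eikonal inverse problem *)

Theorem proposition2p4 (R : realType) (d N : nat)
  (* the domain and the slowness function *)
  (Omega : set 'cV[R]_d) (x0 : 'cV[R]_d)
  (hOmega : lipschitz_domain Omega) (hbounded : bounded_set Omega)
  (hx0 : Omega x0)
  (sstar sbar : 'cV[R]_d -> R) (psi : nat -> 'cV[R]_d -> R)
  (hsstar : in_Linfty Omega sstar) (hsbar : in_Linfty Omega sbar)
  (hpsi : forall i, in_Linfty Omega (psi i))
  (hsstar_ge0 : \forall x \ae lebesgue_vec d, Omega x -> 0 <= sstar x)
  (b : nat -> R) (hb : forall i, b i = Linfty_norm Omega (psi i))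
  (c p : R) (hc : 0 < c) (hp : 1 < p)
  (hbp : forall i, b i < c * i.+1%:R `^ (- p))
  (s : 'cV[R]_d -> Uspace b -> R)
  (hs : forall u, \forall x \ae lebesgue_vec d, Omega x ->
    s x u = sstar x +
      expR (sbar x + limn (series (fun i => Ucoord u i * psi i x))))
  (hs_continuous : forall u, {within closure Omega, continuous (s ^~ u)})
  (hs_gt0 : forall u x, closure Omega x -> 0 < s x u)
  (* the prior *)
  (mu : probability (Rinf R) R) (hmu : product_gaussian mu)
  (gamma : probability (Uspace b) R) (hgamma : is_prior mu gamma)
  (* the forward map *)
  (T : 'cV[R]_d -> Uspace b -> R)
  (hT : forall u, eikonal_soner_solution Omega x0 (s ^~ u) (T ^~ u))
  (hT_repr : forall u x, closure Omega x ->
    T x u = travel_time Omega x0 (s ^~ u) x)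
  (xs : 'I_N -> 'cV[R]_d) (hxs : forall j, closure Omega (xs j))
  (G : Uspace b -> 'cV[R]_N) (hG : forall u, G u = \col_j T (xs j) u)
  (* the observation *)
  (Sigma Sigma_inv_sqrt : 'M[R]_N) (hSigma : posdefmx Sigma)
  (hSigma_inv_sqrt : is_inv_sqrtmx Sigma Sigma_inv_sqrt)
  (dW : measure_display) (W : measurableType dW) (P : probability W R)
  (u : {RV P >-> Uspace b}) (vartheta : {RV P >-> 'cV[R]_N})
  (hu : forall A, measurable A -> distribution P u A = gamma A)
  (hvartheta : has_gaussian_law Sigma vartheta)
  (hindep : independent_rv u vartheta)
  (delta : W -> 'cV[R]_N) (hdelta : forall w, delta w = G (u w) + vartheta w)
  (* the posterior *)
  (posterior : 'cV[R]_N -> probability (Uspace b) R)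
  (hposterior : regular_conditional_distribution u delta posterior) :
  let Phi := potential Sigma_inv_sqrt G in
  let Z y := \int[gamma]_v expR (- Phi v y) in
  \forall y \ae pushforward P delta,
    [/\ posterior y `<< gamma,
        0 < Z y &
        'd (charge_of_finite_measure (posterior y)) '/d gamma
          = (fun v => ((Z y)^-1 * expR (- Phi v y))%:E) %[ae gamma]].
Proof.
move=> Phi Z; have [oOmega _ _] := hOmega.
have b0 : forall i, 0 <= b i by exact: (weight_ge0 hb).
have sL := slowness_lipschitz oOmega hpsi hsstar_ge0 hb hs hs_continuous.
have mG : measurable_fun setT G.
  apply: measurable_fun_mxP => i j; rewrite ord1.
  rewrite (_ : (fun v => _) =
      (fun v => travel_time Omega x0 (s ^~ v) (xs i) : measurableTypeR R)).
    apply: measurable_travel_time => // v y Dy.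
    by rewrite ltW// hs_gt0.
  by apply/funext => v; rewrite hG mxE hT_repr.
have C0 := gaussian_const_gt0 hvartheta.
have pdfE := gaussian_pdfE _ hSigma_inv_sqrt.
have mpdf := measurable_gaussian_pdf hSigma_inv_sqrt.
have pdf_gt0 y : 0 < gaussian_pdf Sigma y by rewrite pdfE mulr_gt0// expR_gt0.
have pdf_le y : gaussian_pdf Sigma y <= gaussian_const Sigma.
  rewrite pdfE ler_piMr ?(ltW C0)// -expR0 ler_expR oppr_le0.
  by rewrite mulr_ge0// sqr_ge0.
have deltaE := funext hdelta; subst delta.
have [N0 [mN0 PN0 N0P]] := bayes_formula mG mpdf pdf_gt0 hu hvartheta hindep
  hposterior pdf_le (Uspace_measurableE b) (@lower_orthant_setI_closed R b)
  (@range_lower_orthantT R b).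
exists N0; split => //; apply: subset_trans N0P => y; apply: contra_not.
have likE v : likelihood G (gaussian_pdf Sigma) (v, y) =
    gaussian_const Sigma * expR (- Phi v y).
  by rewrite /likelihood /= pdfE.
have evE : evidence gamma G (gaussian_pdf Sigma) y = gaussian_const Sigma * Z y.
  have mexp : measurable_fun setT (fun v => expR (- Phi v y)).
    rewrite (_ : (fun v => _) = (fun v => (gaussian_const Sigma)^-1 *
        likelihood G (gaussian_pdf Sigma) (v, y))).
      apply: measurable_funM; first exact: measurable_cst.
      exact: measurable_likelihoodl.
    by apply/funext => v; rewrite likE mulKf// gt_eqF.
  have : ((evidence gamma G (gaussian_pdf Sigma) y)%:E =
      (gaussian_const Sigma)%:E * \int[gamma]_v (expR (- Phi v y))%:E)%E.
    rewrite -(evidenceE gamma mG mpdf pdf_gt0 pdf_le) /likelihood_mass.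
    under eq_integral do rewrite likE EFinM.
    rewrite ge0_integralZl//; first exact/measurable_EFinP.
    by rewrite lee_fin ltW.
  (* An infinite integral would contradict the finiteness of the evidence. *)
  rewrite /Z /Rintegral; case: integral => [r|/esym|/esym]/=.
  - by rewrite -EFinM => -[].
  - by rewrite mulry gtr0_sg// mul1e.
  - by rewrite mulrNy gtr0_sg// mul1e.
move=> -[dom Z0 rn]; rewrite evE in Z0 rn.
split=> //; first by rewrite pmulr_rgt0 in Z0.
apply: filterS rn => v /= rnv vT; rewrite rnv// likE.
congr EFin; rewrite invfM mulrACA mulVf ?mul1r//.
by rewrite gt_eqF.
Qed.
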